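(* Let $f(X)=a_{0}+a_{1}X+\cdots +a_{n}X^{n}\in\mathbb{Z}[X]$, $a_{0}a_{n}\neq 0$. Suppose there exist two distinct primes $p,q$ and two distinct indices $j_{1},j_{2}\in \{ 1,\dots ,n-1 \}$ with $j_{1}+j_{2}\neq n$ such that (i) $\nu _{p}(a_{0}) = 0$; $\frac{\nu _{p}(a_{i})}{i} > \frac{\nu _{p}(a_{j_{1}})}{j_{1}}$ for $0<i<j_{1}$; $\nu _{p}(a_{j_{1}})>0$; $\nu _{p}(a_{i}) > \frac{n-i}{n-j_{1}}\, \nu _{p}(a_{j_{1}})+\frac{i-j_{1}}{n-j_{1}}\, \nu _{p}(a_{n})$ for $j_{1}<i<n$; and $\frac{\nu _{p}(a_{n})}{n}>\frac{\nu _{p}(a_{j_{1}})}{j_{1}}$; (ii) $\nu _{q}(a_{0})>0$; $\frac{\nu _{q}(a_{i})}{j_{2}-i}>\frac{\nu _{q}(a_{0})}{j_{2}}$ for $0<i<j_{2}$; $\nu _{q}(a_{j_{2}})=0$; $\frac{\nu _{q}(a_{i})}{i-j_{2}}>\frac{\nu _{q}(a_{n})}{n-j_{2}}$ for $j_{2}<i<n$; and $\nu _{q}(a_{n})>0$; (iii) $\gcd(\nu _{p}(a_{j_{1}}),j_{1})=\gcd(\nu _{p}(a_{n})-\nu _{p}(a_{j_{1}}),n-j_{1})=1$ and $\gcd(\nu _{q}(a_{0}),j_{2})=\gcd(\nu _{q}(a_{n}),n-j_{2})=1$. Then $f$ is irreducible over $\mathbb{Q}$.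
   Context: For a prime $p$ and a nonzero integer $m$, $\nu_p(m)$ is the largest integer $i$ such that $p^i\mid m$; by convention $\nu_p(0)=\infty$ (so lower bounds on $\nu_p(a_i)$ hold automatically when $a_i=0$). *)

(* Defs.v *)
From mathcomp Require Import all_boot all_order all_algebra.
From mathcomp Require Export constructive_ereal.

Set Implicit Arguments.
Unset Strict Implicit.
Unset Printing Implicit Defensive.

Import Order.TTheory GRing.Theory Num.Theory.
Local Open Scope ring_scope.

(* The value at m = 0 is logn p 0 = 0, not +oo. *)
Definition valn (p : nat) (m : int) : nat := logn p `|m|%N.

(* Extended rationals, so that valuations can be divided by positive integers;
   +oo / i = +oo for every natural number i > 0. *)
Definition nu (p : nat) (m : int) : \bar rat :=
  if m == 0 then +oo%E else (valn p m)%:R%:E.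

(* Main.v *)
Require Import Defs.
From mathcomp Require Import all_boot all_order all_algebra.
From mathcomp Require Import constructive_ereal.
From mathcomp Require Import zify ring lra.

(* By multiplicativity of the sides of a given slope (Dumas), the Newton polygon
   of a factor of [f] is assembled from parts of the sides of that of [f]. The
   hypotheses at [p] give two sides, of widths [j1] and [n - j1], and those at
   [q] two sides, of widths [j2] and [n - j2]; by coprimality none of them can
   be cut at a lattice point. So the degree of a factor lies in
   {0, j1, n - j1, n} and in {0, j2, n - j2, n}, two sets that share only 0
   and n. *)

Set Implicit Arguments.
Unset Strict Implicit.
Unset Printing Implicit Defensive.

Import Order.TTheory GRing.Theory Num.Theory.
Local Open Scope ring_scope.

Lemma nu_fin p x : x != 0 -> nu p x = (valn p x)%:R%:E.
Proof. by rewrite /nu => /negPf ->. Qed.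

Lemma nu_finE p x c : nu p x = c%:E -> x != 0 /\ (valn p x)%:R = c.
Proof. by rewrite /nu; case: eqP => //= _ [<-]. Qed.

Lemma nu0 p : nu p 0 = +oo%E.
Proof. by rewrite /nu eqxx. Qed.

Lemma nuN p x : nu p (- x) = nu p x.
Proof. by rewrite /nu /valn oppr_eq0 abszN. Qed.

Lemma nuM p x y : nu p (x * y) = (nu p x + nu p y)%E.
Proof.
have [->|x0] := eqVneq x 0; first by rewrite mul0r nu0 /nu; case: ifP.
have [->|y0] := eqVneq y 0; first by rewrite mulr0 nu0 /nu; case: ifP.
rewrite !nu_fin ?mulf_neq0// /valn abszM lognM ?absz_gt0//.
by rewrite natrD EFinD.
Qed.

Lemma nuD_ge p x y : prime p -> (Order.min (nu p x) (nu p y) <= nu p (x + y))%E.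
Proof.
move=> pp.
have [->|x0] := eqVneq x 0; first by rewrite add0r ge_min lexx orbT.
have [->|y0] := eqVneq y 0; first by rewrite addr0 ge_min lexx.
have [->|xy0] := eqVneq (x + y) 0; first by rewrite nu0 leey.
rewrite !nu_fin// ge_min !lee_fin !ler_nat -geq_min /valn.
rewrite -pfactor_dvdn ?absz_gt0//.
set k := minn _ _.
suff : ((p ^ k)%N%:Z %| x + y)%Z by rewrite dvdzE.
apply: rpredD; rewrite [_ \in _]dvdzE /= pfactor_dvdn ?absz_gt0//;
  by rewrite geq_min leqnn ?orbT.
Qed.

Lemma nu_sum_gt p (I : Type) (s : seq I) (P : pred I) (F : I -> int) (c : rat) :
  prime p -> (forall i, P i -> (c%:E < nu p (F i))%E) ->
  (c%:E < nu p (\sum_(i <- s | P i) F i)%R)%E.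
Proof.
move=> pp cF; apply: (big_ind (fun x => (c%:E < nu p x)%E)) => //.
  by rewrite nu0 ltry.
by move=> x y cx cy; apply: lt_le_trans (nuD_ge x y pp); rewrite lt_min cx.
Qed.

(** Otherwise x = (x + y) - y would be a sum of two terms of valuation larger than that of x. *)
Lemma nuD_gt p x y : prime p -> (nu p x < nu p y)%E -> nu p (x + y) = nu p x.
Proof.
move=> pp xy; apply/eqP; rewrite eq_le; apply/andP; split; last first.
  by rewrite (le_trans _ (nuD_ge x y pp))// le_min lexx ltW.
rewrite leNgt; apply/negP => xxy.
have := nuD_ge (x + y) (- y) pp; rewrite addrK nuN leNgt => /negP; apply.
by rewrite lt_min xxy.
Qed.

(** * Sides of Newton polygons *)

(* The side of slope [s] of the Newton polygon of [g] (possibly reduced to the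
   vertex [l = r]): it is the part of the supporting line
   [i |-> m + s i] over the interval [l, r]. *)
Definition newton_edge p (s : rat) (g : {poly int}) (m : rat) (l r : nat) :=
  [/\ forall i, ((m + s * i%:R)%:E <= nu p g`_i)%E,
      nu p g`_l = (m + s * l%:R)%:E, nu p g`_r = (m + s * r%:R)%:E
    & forall i, (i < l)%N || (r < i)%N -> ((m + s * i%:R)%:E < nu p g`_i)%E].

(** Minimise the valuation of the coefficient of index i minus s i, over the nonzero coefficients:
    [m] is the minimum, and [l], [r] are the first and last indices attaining it. *)
Lemma newton_edge_exists p s g :
  g != 0 -> exists m l r, newton_edge p s g m l r.
Proof.
move=> g0; pose W i : rat := (valn p g`_i)%:R - s * i%:R.
have sg : (0 < size g)%N by rewrite size_poly_gt0.
have sg' : ((size g).-1 < size g)%N by rewrite prednK.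
have Pi0 : g`_(Ordinal sg') != 0 by rewrite /= -lead_coefE lead_coef_eq0.
case: (@Order.TotalTheory.arg_minP _ _ _ (Ordinal sg')
  (fun i : 'I_(size g) => g`_i != 0) (fun i => W i) Pi0) => i0 gi0 minW.
have ltsz i : g`_i != 0 -> (i < size g)%N.
  by move=> gi; rewrite ltnNge; apply: contra gi => ?; rewrite nth_default.
have Wmin i : g`_i != 0 -> W i0 <= W i.
  by move=> gi; apply: (minW (Ordinal (ltsz _ gi))).
pose P i := (g`_i != 0) && (W i == W i0).
have exP : exists i, P i by exists i0; rewrite /P gi0 eqxx.
have boundP i : P i -> (i <= size g)%N by case/andP => /ltsz /ltnW.
have nuP i : P i -> nu p g`_i = (W i0 + s * i%:R)%:E.
  by case/andP => gi /eqP <-; rewrite nu_fin// /W subrK.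
exists (W i0); case: (ex_minnP exP) => l Pl lmin; exists l.
case: (ex_maxnP exP boundP) => r Pr rmax; exists r.
have ge i : ((W i0 + s * i%:R)%:E <= nu p g`_i)%E.
  have [->|gi] := eqVneq g`_i 0; first by rewrite nu0 leey.
  by rewrite nu_fin// lee_fin -lerBrDr Wmin.
split; rewrite ?nuP// => i ilr; rewrite lt_neqAle ge andbT.
apply: contraL ilr => /eqP/esym/nu_finE [gi Wi].
have Pi : P i by rewrite /P gi /W Wi addrK eqxx.
by rewrite negb_or -!leqNgt lmin ?rmax.
Qed.

Lemma newton_edge_unique p s g m l r m' l' r' :
  newton_edge p s g m l r -> newton_edge p s g m' l' r' -> l = l' /\ r = r'.
Proof.
move=> [ge gl gr gt] [ge' gl' gr' gt'].
have mm' : m = m'.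
  apply/eqP; rewrite eq_le; apply/andP; split.
    by have := ge l'; rewrite gl' lee_fin lerD2r.
  by have := ge' l; rewrite gl lee_fin lerD2r.
subst m'; split; apply/eqP; rewrite eqn_leq; apply/andP; split;
  rewrite leqNgt; apply/negP => lt.
- by have := gt l'; rewrite lt gl' ltxx => /(_ isT).
- by have := gt' l; rewrite lt gl ltxx => /(_ isT).
- by have := gt' r; rewrite lt orbT gr ltxx => /(_ isT).
- by have := gt r'; rewrite lt orbT gr' ltxx => /(_ isT).
Qed.

Lemma newton_edge_leq p s g m l r : newton_edge p s g m l r -> (l <= r)%N.
Proof.
case=> [_ _ gr gt]; rewrite leqNgt; apply/negP => lt.
by have := gt r; rewrite lt gr ltxx => /(_ isT).
Qed.

(** In the convolution sum at index [l + l'], all terms but the product of the coefficients at [l]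
    and [l'] lie strictly above the new supporting line, so that no cancellation can occur; likewise
    at [r + r']. *)
Lemma newton_edgeM p s g h m l r m' l' r' : prime p ->
  newton_edge p s g m l r -> newton_edge p s h m' l' r' ->
  newton_edge p s (g * h) (m + m') (l + l') (r + r').
Proof.
move=> pp [ge gl gr gt] [ge' gl' gr' gt'].
(* The heights of the two lines at i and k - i have a sum independent of i, because the slope is
   common. *)
have line i k : (i <= k)%N -> ((m + m' + s * k%:R)%:E
    = (m + s * i%:R)%:E + (m' + s * (k - i)%N%:R)%:E :> \bar rat)%E.
  by move=> ik; rewrite -EFinD natrB//; congr EFin; ring.
have geM i k : (i <= k)%N ->
    ((m + m' + s * k%:R)%:E <= nu p (g`_i * h`_(k - i)))%E.
  by move=> ik; rewrite nuM (line i)//; apply: leeD.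
have gtM i k : (i <= k)%N -> [|| i < l, r < i, k - i < l' | r' < k - i]%N ->
    ((m + m' + s * k%:R)%:E < nu p (g`_i * h`_(k - i)))%E.
  move=> ik; rewrite nuM (line i)// orbA => /orP [lt|lt].
    by apply: lte_leD => //; apply: gt.
  by apply: lee_ltD => //; apply: gt'.
have vertex i0 j0 : nu p g`_i0 = (m + s * i0%:R)%:E ->
    nu p h`_j0 = (m' + s * j0%:R)%:E ->
    (forall i, (i <= i0 + j0)%N -> i != i0 ->
       [|| i < l, r < i, i0 + j0 - i < l' | r' < i0 + j0 - i]%N) ->
    nu p (g * h)`_(i0 + j0) = (m + m' + s * (i0 + j0)%N%:R)%:E.
  move=> gi0 hj0 out.
  have lti0 : (i0 < (i0 + j0).+1)%N by lia.
  have nu_i0 : nu p (g`_i0 * h`_(i0 + j0 - i0)) =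
      (m + m' + s * (i0 + j0)%N%:R)%:E.
    by rewrite nuM addKn gi0 hj0 (line i0) ?leq_addr// addKn.
  rewrite coefM (bigD1 (Ordinal lti0))//= nuD_gt// nu_i0.
  apply: nu_sum_gt => // -[i /= ile] ne.
  by apply: (gtM i _ ile); apply: (out i ile ne).
split.
- move=> k; rewrite coefM.
  apply: (big_ind (fun x => ((m + m' + s * k%:R)%:E <= nu p x)%E)).
  + by rewrite nu0 leey.
  + by move=> x y cx cy; apply: le_trans (nuD_ge x y pp); rewrite le_min cx.
  + by move=> [i ik] _ /=; apply: (geM i k ik).
- by apply: vertex => // i ile ine; lia.
- by apply: vertex => // i ile ine; lia.
(* For such k, every split i + (k - i) has an index outside its interval. *)
- move=> k lt; rewrite coefM; apply: nu_sum_gt => // -[i /= ik] _.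
  by apply: (gtM i k ik); lia.
Qed.

(** Both ends of the side are lattice points, so V (r - l) is J times an integer, and Gauss's lemma
    on divisibility applies. *)
Lemma newton_edge_dvd p (V : int) (J : nat) g m l r : (0 < J)%N ->
  coprimez V J -> newton_edge p (V%:~R / J%:R) g m l r -> (J %| r - l)%N.
Proof.
move=> J0 cVJ edge; have lr := newton_edge_leq edge.
case: edge => [_ /nu_finE [_ gl] /nu_finE [_ gr] _].
set a := valn _ _ in gl; set b := valn _ _ in gr.
have J0' : (J%:R : rat) != 0 by rewrite pnatr_eq0 -lt0n.
have E : V * (r - l)%N%:Z = J%:Z * (b%:Z - a%:Z).
  apply: (@intr_inj rat); rewrite !rmorphM rmorphB /= -!pmulrn gr gl natrB//.
  by field.
rewrite -[(_ %| _)%N]/(J%:Z %| (r - l)%N%:Z)%Z.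
by rewrite -(Gauss_dvdzr (n := V)) ?E ?dvdz_mulr// coprimez_sym.
Qed.

(** Comparing each line with the other's endpoint, at [l'] and at [r], and adding gives (s' - s) (l'
    - r) >= 0. *)
Lemma newton_edge_slopes p s s' g m l r m' l' r' : s < s' ->
  newton_edge p s g m l r -> newton_edge p s' g m' l' r' -> (r <= l')%N.
Proof.
move=> ss' [ge _ gr _] [ge' gl' _ _].
have := ge l'; rewrite gl' lee_fin => A.
have := ge' r; rewrite gr lee_fin => B.
by rewrite -(ler_nat rat); nra.
Qed.

Lemma EFin_div_nat (R : realFieldType) (c : R) (k : nat) : (0 < k)%N ->
  (c%:E / k%:R%:E)%E = (c / k%:R)%:E.
Proof. by move=> k0; rewrite inver pnatr_eq0 eqn0Ngt k0. Qed.

Lemma lte_pdivlMr_nat (R : realFieldType) (c : R) (x : \bar R) (k : nat) :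
  (0 < k)%N -> (c%:E < x / k%:R%:E)%E = ((c * k%:R)%:E < x)%E.
Proof.
by move=> k0; rewrite inver pnatr_eq0 eqn0Ngt k0 lte_pdivlMr ?ltr0n// EFinM.
Qed.

(** * Degrees of factors of a polynomial whose Newton polygon has two sides *)

Lemma size_factor_two_edges p (f g h : {poly int}) (n j : nat) (a b c : nat) :
  prime p -> f = g * h -> size f = n.+1 -> (0 < j < n)%N ->
  nu p f`_0 = a%:R%:E -> nu p f`_j = b%:R%:E -> nu p f`_n = c%:R%:E ->
  let s1 : rat := (b%:Z - a%:Z)%:~R / j%:R in
  let s2 : rat := (c%:Z - b%:Z)%:~R / (n - j)%N%:R in
  s1 < s2 -> coprimez (b%:Z - a%:Z) j%:Z ->
  coprimez (c%:Z - b%:Z) (n - j)%N%:Z ->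
  (forall i, (0 < i < j)%N -> ((a%:R + s1 * i%:R)%:E < nu p f`_i)%E) ->
  (forall i, (j < i < n)%N -> ((b%:R + s2 * (i - j)%N%:R)%:E < nu p f`_i)%E) ->
  (size g).-1 \in [:: 0%N; j; (n - j)%N; n].
Proof.
move=> pp fE sf /andP[j0 jn] fa fb fc s1 s2 s12 cop1 cop2 gt1 gt2.
have f0 : f != 0 by rewrite -size_poly_gt0 sf.
have s1j : s1 * j%:R = b%:R - a%:R.
  by rewrite /s1 divfK ?pnatr_eq0 -?lt0n// rmorphB /= -!pmulrn.
have s2j : s2 * (n%:R - j%:R) = c%:R - b%:R.
  rewrite -natrB 1?ltnW// /s2 divfK ?pnatr_eq0 -?lt0n ?subn_gt0//.
  by rewrite rmorphB /= -!pmulrn.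
have nj0 : (0 < n - j)%N by rewrite subn_gt0.
have dvd1 k m l r (ek : newton_edge p s1 k m l r) :=
  newton_edge_dvd j0 cop1 ek.
have dvd2 k m l r (ek : newton_edge p s2 k m l r) :=
  newton_edge_dvd nj0 cop2 ek.
(* From here on the slopes enter only through [s1j], [s2j], [s12] and the divisibilities [dvd1],
   [dvd2]. *)
clearbody s1 s2.
have jpos : (0 : rat) < j%:R by rewrite ltr0n.
have jn' : (j%:R : rat) < n%:R by rewrite ltr_nat.
have nbig i : (n < i)%N -> nu p f`_i = +oo%E.
  by move=> ni; rewrite nth_default ?nu0 ?sf.
have gt2' i : (j < i < n)%N -> ((b%:R + s2 * (i%:R - j%:R))%:E < nu p f`_i)%E.
  by move=> ijn; rewrite -natrB ?gt2//; lia.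
(* To the right of j the points lie on or above the line of slope [s2] through (j, b), which is
   there strictly above the line of slope [s1]. *)
have edge1 : newton_edge p s1 f a%:R 0 j.
  have out i : (j < i)%N -> ((a%:R + s1 * i%:R)%:E < nu p f`_i)%E.
    move=> ji; have ji' : (j%:R : rat) < i%:R by rewrite ltr_nat.
    have := ltngtP i n; case=> [ltin|/nbig ->|->]; last 2 first.
    - by rewrite ltry.
    - by rewrite fc lte_fin; nra.
    - apply: lt_trans (gt2' i _); last by rewrite ji.
      by rewrite lte_fin; nra.
  split=> [i|||i /orP[]//]; rewrite ?mulr0 ?addr0 ?fa ?fb//; last exact: out.
  - have := ltngtP i j; case=> [ij|/out/ltW//|->]; last first.
      by rewrite fb lee_fin; nra.
    by case: i ij => [|i ij]; rewrite ?fa ?mulr0 ?addr0// ltW// gt1.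
  - by congr EFin; lra.
(* The constant is the height at 0 of the line of slope [s2] through (j, b). *)
have edge2 : newton_edge p s2 f (b%:R - s2 * j%:R) j n.
  have E (i : nat) : b%:R - s2 * j%:R + s2 * i%:R = b%:R + s2 * (i%:R - j%:R).
    by ring.
  have out i : (i < j)%N -> ((b%:R - s2 * j%:R + s2 * i%:R)%:E < nu p f`_i)%E.
    move=> ij; have ij' : (i%:R : rat) < j%:R by rewrite ltr_nat.
    case: i ij ij' => [|i] ij ij'; first by rewrite fa lte_fin; nra.
    by apply: lt_trans (gt1 _ _) => //; rewrite lte_fin; nra.
  split=> [i|||i /orP[/out//|/nbig ->]]; rewrite ?E ?fb ?fc ?ltry//.
  - have := ltngtP i j; case=> [/out/ltW|ji|->]; first by rewrite E.
      have := ltngtP i n; case=> [ltin|/nbig ->|->]; rewrite ?leey//.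
        by rewrite ltW// gt2'// ji.
      by rewrite fc lee_fin; lra.
    by rewrite fb lee_fin; lra.
  - by congr EFin; lra.
  - by congr EFin; lra.
have g0 : g != 0 by apply: contraNneq f0 => g0; rewrite fE g0 mul0r.
have h0 : h != 0 by apply: contraNneq f0 => h0; rewrite fE h0 mulr0.
have [mg1 [lg1 [rg1 eg1]]] := newton_edge_exists p s1 g0.
have [mh1 [lh1 [rh1 eh1]]] := newton_edge_exists p s1 h0.
have [mg2 [lg2 [rg2 eg2]]] := newton_edge_exists p s2 g0.
have [mh2 [lh2 [rh2 eh2]]] := newton_edge_exists p s2 h0.
have := newton_edgeM pp eg1 eh1.
rewrite -fE => /(newton_edge_unique edge1) [L1 R1].
have := newton_edgeM pp eg2 eh2.
rewrite -fE => /(newton_edge_unique edge2) [L2 R2].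
have gg := newton_edge_slopes s12 eg1 eg2.
have hh := newton_edge_slopes s12 eh1 eh2.
have r2s k m l r : newton_edge p s2 k m l r -> (r < size k)%N.
  move=> [_ _ /nu_finE[kr _] _]; rewrite ltnNge; apply: contra kr => ?.
  by rewrite nth_default.
have sg := r2s _ _ _ _ eg2; have sh := r2s _ _ _ _ eh2.
have sgh : (size g + size h).-1 = n.+1 by rewrite -sf fE size_mul.
have le2 := newton_edge_leq eg2; have leh2 := newton_edge_leq eh2.
have zero_or_max k d : (0 < d)%N -> (d %| k)%N -> (k <= d)%N ->
  k = 0%N \/ k = d.
  move=> d0 /dvdnP [[|[|x]] ->]; rewrite ?mul0n ?mul1n; [by left|by right|].
  by rewrite mulSn mulSn; move: d0; clear; lia.
have w1 : (rg1 - lg1 <= j)%N by clear - L1 R1; lia.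
have w2 : (rg2 - lg2 <= n - j)%N by clear - L2 R2 leh2; lia.
(* Since [rg1 + rh1] = j = [lg2 + lh2], the inequalities [gg] and [hh] are equalities: the two sides
   of g are adjacent. They start at [lg1] = 0, and comparing [R2] with [sgh] shows that they end at
   the degree of g. This degree is thus the sum of two widths, one in {0, j} and one in {0, n -
   j}. *)
move: (zero_or_max _ _ j0 (dvd1 _ _ _ _ eg1) w1).
move: (zero_or_max _ _ nj0 (dvd2 _ _ _ _ eg2) w2).
rewrite !inE; clear - L1 R1 L2 R2 gg hh sg sh sgh le2 leh2 jn; lia.
Qed.

(** * Irreducibility by comparing the degrees allowed at p and at q *)

Theorem theorem1p35 (n : nat) (f : {poly int})
  (size_f : size f = n.+1)
  (a0an_neq0 : f`_0 * f`_n != 0)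
  (p q : nat) (p_prime : prime p) (q_prime : prime q) (p_neq_q : p != q)
  (j1 j2 : nat)
  (j1_range : (1 <= j1 <= n - 1)%N) (j2_range : (1 <= j2 <= n - 1)%N)
  (j1_neq_j2 : j1 != j2) (j1j2_neq_n : (j1 + j2 != n)%N)
  (cond_i :
    [/\ nu p f`_0 = 0%E,
        forall i : nat, (0 < i < j1)%N ->
          (nu p f`_i / i%:R%:E > nu p f`_j1 / j1%:R%:E)%E,
        (nu p f`_j1 > 0)%E,
        forall i : nat, (j1 < i < n)%N ->
          (nu p f`_i >
             ((n - i)%N%:R / (n - j1)%N%:R)%R%:E * nu p f`_j1
             + ((i - j1)%N%:R / (n - j1)%N%:R)%R%:E * nu p f`_n)%E
      & (nu p f`_n / n%:R%:E > nu p f`_j1 / j1%:R%:E)%E])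
  (cond_ii :
    [/\ (nu q f`_0 > 0)%E,
        forall i : nat, (0 < i < j2)%N ->
          (nu q f`_i / (j2 - i)%N%:R%:E > nu q f`_0 / j2%:R%:E)%E,
        nu q f`_j2 = 0%E,
        forall i : nat, (j2 < i < n)%N ->
          (nu q f`_i / (i - j2)%N%:R%:E > nu q f`_n / (n - j2)%N%:R%:E)%E
      & (nu q f`_n > 0)%E])
  (cond_iii :
    [/\ gcdn (valn p f`_j1) j1 = 1%N,
        gcdz ((valn p f`_n)%:Z - (valn p f`_j1)%:Z) (n - j1)%N%:Z = 1,
        gcdn (valn q f`_0) j2 = 1%N
      & gcdn (valn q f`_n) (n - j2) = 1%N]) :
  irreducible_poly (map_poly (intr : int -> rat) f).
Proof.
have n_pos : (0 < n)%N by lia.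
have /andP[f0 fn] : (f`_0 != 0) && (f`_n != 0) by rewrite -negb_or -mulf_eq0.
case: cond_i => [p0 p1 _ p2 pn]; case: cond_ii => [q0 q1 qj q2 _].
case: cond_iii => [gp1 gp2 gq1 gq2].
split=> [|d]; first by rewrite size_rat_int_poly size_f; lia.
(* By Gauss's lemma a rational divisor is a scalar multiple of some g dividing f over the
   integers. *)
move=> d1 /dvdpP_rat_int [g [a a0 dE] [h fE]].
have [d0|degd] := eqVneq (size g) n.+1; last exfalso.
  rewrite -dvdp_size_eqp ?size_rat_int_poly ?size_f dE.
    by rewrite size_scale// size_rat_int_poly d0.
  by rewrite dvdpZl// fE rmorphM /= dvdp_mulIl.
have sg1 : size g != 1%N.
  by move: d1; rewrite dE size_scale// size_rat_int_poly.
have g_neq0 : (0 < size g)%N.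
  rewrite lt0n size_poly_eq0; apply: contraNneq f0 => g0.
  by rewrite fE g0 mul0r coef0.
have j1_pos : (0 < j1)%N by lia.
(* Otherwise the right-hand side of the strict inequality [pn] would be +oo. *)
have fj1 : f`_j1 != 0.
  apply: contraTneq pn => ->; rewrite nu0 gt0_mulye -?leNgt ?leey//.
  by rewrite inver pnatr_eq0 gt_eqF// lte_fin invr_gt0 ltr0n.
have j2_pos : (0 < j2)%N by lia.
have nj1_pos : (0 < n - j1)%N by lia.
have nj2_pos : (0 < n - j2)%N by lia.
have [vqj fqj] : valn q f`_j2 = 0%N /\ f`_j2 != 0.
  by case/nu_finE: qj => fq /eqP; rewrite pnatr_eq0 => /eqP.
have degp : (size g).-1 \in [:: 0%N; j1; (n - j1)%N; n].
  move: pn; rewrite (nu_fin _ fj1) (nu_fin _ fn) !EFin_div_nat// lte_fin => pn.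
  apply: (@size_factor_two_edges p f g h n j1 0 (valn p f`_j1)
    (valn p f`_n)) => //.
  - by lia.
  - exact: nu_fin.
  - exact: nu_fin.
  (* By [pn] the point at [j1] lies strictly below the chord from 0 to n, so the slope increases at
     [j1]. *)
  - rewrite subr0 rmorphB /= -!pmulrn natrB; last lia.
    have j10 : (0 : rat) < j1%:R by rewrite ltr0n.
    have nj0 : (0 : rat) < n%:R - j1%:R by rewrite subr_gt0 ltr_nat; lia.
    rewrite ltr_pdivrMr// mulrAC ltr_pdivlMr//.
    by move: pn; rewrite ltr_pdivrMr// mulrAC ltr_pdivlMr ?ltr0n//; nra.
  - by rewrite subr0 /coprimez /gcdz /= gp1.
  - by rewrite /coprimez gp2.
  - move=> i ij; have := p1 i ij; rewrite (nu_fin _ fj1) EFin_div_nat//.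
    rewrite lte_pdivlMr_nat; last lia.
    by rewrite subr0 add0r -pmulrn.
  (* The bound in [p2] is the height at i of the chord from [j1] to n, written as a convex
     combination. *)
  - move=> i ij; have := p2 i ij; rewrite (nu_fin _ fj1) (nu_fin _ fn).
    rewrite -!EFinM -EFinD.
    congr (_%:E < _)%E; rewrite rmorphB /= -!pmulrn !natrB; [|lia..].
    by field; rewrite subr_eq0 eqr_nat; lia.
have degq : (size g).-1 \in [:: 0%N; j2; (n - j2)%N; n].
  apply: (@size_factor_two_edges q f g h n j2 (valn q f`_0) 0
    (valn q f`_n)) => //.
  - by lia.
  - exact: nu_fin.
  - exact: nu_fin.
  (* The first slope is negative and the second is nonnegative. *)
  - rewrite sub0r subr0 rmorphN /= -!pmulrn.
    apply: (@lt_le_trans _ _ 0); last by rewrite divr_ge0.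
    rewrite mulNr oppr_lt0 divr_gt0 ?ltr0n//.
    by move: q0; rewrite (nu_fin _ f0) lte_fin ltr0n.
  - by rewrite sub0r /coprimez /gcdz abszN /= gq1.
  - by rewrite subr0 /coprimez /gcdz /= gq2.
  - move=> i ij; have := q1 i ij; rewrite (nu_fin _ f0) EFin_div_nat//.
    rewrite lte_pdivlMr_nat; last lia.
    congr (_%:E < _)%E; rewrite sub0r rmorphN /= -pmulrn natrB; last lia.
    by field; rewrite pnatr_eq0; lia.
  - move=> i ij; have := q2 i ij; rewrite (nu_fin _ fn) EFin_div_nat//.
    rewrite lte_pdivlMr_nat; last lia.
    by rewrite subr0 add0r -pmulrn.
(* [(size g).-1] is 0 for the zero polynomial as well as for constants; [g_neq0] and [sg1] exclude
   both. *)
move: degp degq; rewrite !inE.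
clear - degd sg1 g_neq0 j1_range j2_range j1_neq_j2 j1j2_neq_n; lia.
Qed.
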